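(* Let $\mathcal{A}$ be a quasi-abelian category and $\Lambda$ a totally ordered, uniquely divisible abelian group. The modular law holds in $\mathcal{A}$ if and only if for all epi-monics $f: M \to N$ in $W\mathcal{A}^{\mathrm{pre}}$, we have that $f$ is strictly compatible with the filtrations precisely when it is strictly co-compatible with the filtrations.
   Context: In an additive category with kernels and cokernels, put $\mathrm{Coim} f = \mathrm{Coker}(\ker f)$ and $\mathrm{Im} f = \mathrm{Ker}(\mathrm{coker} f)$; $f$ is strict if the canonical morphism $\mathrm{Coim} f \to \mathrm{Im} f$ is an isomorphism. Strict monics (strict subobjects) are exactly the kernels, strict epis exactly the cokernels. Epi-monic means both epi and monic. A quasi-abelian category is an additive category with kernels and cokernels in which kernels are stable under pushout and cokernels are stable under pullback. For strict subobjects $A, B$ of $X$: $X/A$ is the cokernel of $A \hookrightarrow X$, $A \cap B$ is the pullback, $A + B$ is the image of $A \oplus B \to X$. For $f: M \to N$ and strict subobjects $P \hookrightarrow M$, $Q \hookrightarrow N$: $f(P) = \mathrm{Im}(P \hookrightarrow M \to N)$ and $f^{-1}(Q)$ is the pullback of $Q \hookrightarrow N$ along $f$. The modular law holds in $\mathcal{A}$ if for all strict subobjects $A \hookrightarrow B \hookrightarrow X$ and $C \hookrightarrow X$ in $\mathcal{A}$, the canonical morphism $A + (B \cap C) \hookrightarrow B \cap (A + C)$ is an isomorphism. An ascending $\Lambda$-indexed filtration on $M \in \mathcal{A}$ is a functor $\Lambda \to \mathcal{A}$, $\lambda \mapsto W_{\leq\lambda}M$ ($\Lambda$ viewed as an ordered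 set) such that: it admits a colimit cone with vertex $M$ for which each $W_{\leq\lambda}M \to M$ is a strict subobject (exhaustiveness); the limit over all $\lambda$ exists and is $0$ (separatedness); and for all $\lambda$ the limit $\lim_{\lambda'>\lambda} W_{\leq\lambda'}M$ exists and equals $W_{\leq\lambda}M$ (right continuity). It is finite if it is isomorphic to a finite flag $0 \hookrightarrow W_{\leq\lambda_0}M \hookrightarrow \dots \hookrightarrow W_{\leq\lambda_r}M = M$ with $\lambda_0 < \dots < \lambda_r$ (the breaks), the filtration being constant precisely on the intervals $\lambda_{i-1} \leq \lambda < \lambda_i$. $W\mathcal{A}^{\mathrm{pre}}$ is the full subcategory of the category $\mathrm{Fun}(\Lambda,\mathcal{A})$ of functors $\Lambda \to \mathcal{A}$ consisting of the finite ascending $\Lambda$-indexed filtrations. It is an additive category with kernels and cokernels. A morphism $f: M \to N$ in $W\mathcal{A}^{\mathrm{pre}}$ (with underlying morphism $f: M \to N$ in $\mathcal{A}$ on colimits) is strictly compatible with the filtrations if $f(W_{\leq\lambda}M) \hookrightarrow f(M) \cap W_{\leq\lambda}N$ is an isomorphism for all $\lambda$. It is strictly co-compatible with the filtrations if $(W_{\leq\lambda}M + \mathrm{Ker}_{\mathcal{A}} f)/\mathrm{Ker}_{\mathcal{A}} f \to f^{-1}(W_{\leq\lambda}N)/\mathrm{Ker}_{\mathcal{A}} f$ is an isomorphism for all $\lambda$.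
   Formalization: The group Λ is assumed nonzero; for Λ = 0 every filtration lives on a zero object, so the condition on epi-monics holds trivially while the modular law can fail (e.g. in Banach spaces). *)

(* Defs.v *)
From HB Require Import structures.
From mathcomp Require Import all_boot all_order all_algebra.
From mathcomp Require Import boolp.

Set Implicit Arguments.
Unset Strict Implicit.
Unset Printing Implicit Defensive.

Import Order.TTheory GRing.Theory.

Local Open Scope ring_scope.

Declare Scope cat_scope.
Delimit Scope cat_scope with cat.
Reserved Notation "g ∘ f" (at level 40, left associativity).

Record category := Category {
  obj :> Type;
  mor : obj -> obj -> Type;
  idm : forall X : obj, mor X X;
  comp : forall X Y Z : obj, mor Y Z -> mor X Y -> mor X Z;
  compA : forall (X Y Z T : obj) (h : mor Z T) (g : mor Y Z) (f : mor X Y),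
    comp h (comp g f) = comp (comp h g) f;
  comp1m : forall (X Y : obj) (f : mor X Y), comp (idm Y) f = f;
  compm1 : forall (X Y : obj) (f : mor X Y), comp f (idm X) = f }.

Arguments idm {c} X.
Arguments comp {c X Y Z} g f.

Notation "g ∘ f" := (comp g f) : cat_scope.
Local Open Scope cat_scope.

Definition is_iso (C : category) (X Y : C) (f : mor X Y) : Prop :=
  exists g : mor Y X, g ∘ f = idm X /\ f ∘ g = idm Y.

Definition is_monic (C : category) (X Y : C) (f : mor X Y) : Prop :=
  forall (Z : C) (g h : mor Z X), f ∘ g = f ∘ h -> g = h.

Definition is_epi (C : category) (X Y : C) (f : mor X Y) : Prop :=
  forall (Z : C) (g h : mor Y Z), g ∘ f = h ∘ f -> g = h.

Definition is_zero_obj (C : category) (Z : C) : Prop :=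
  (forall X : C, exists! f : mor X Z, True) /\
  (forall X : C, exists! f : mor Z X, True).

(* f ∘ p = g ∘ q is cartesian. *)
Definition is_pullback (C : category) (X Y Z P : C)
    (f : mor X Z) (g : mor Y Z) (p : mor P X) (q : mor P Y) : Prop :=
  f ∘ p = g ∘ q /\
  forall (T : C) (x : mor T X) (y : mor T Y), f ∘ x = g ∘ y ->
    exists! h : mor T P, p ∘ h = x /\ q ∘ h = y.

Definition is_pushout (C : category) (X Y Z P : C)
    (f : mor Z X) (g : mor Z Y) (p : mor X P) (q : mor Y P) : Prop :=
  p ∘ f = q ∘ g /\
  forall (T : C) (x : mor X T) (y : mor Y T), x ∘ f = y ∘ g ->
    exists! h : mor P T, h ∘ p = x /\ h ∘ q = y.

Record functor (C D : category) := Functor {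
  fobj :> C -> D;
  fmap : forall X Y : C, mor X Y -> mor (fobj X) (fobj Y);
  fmap1 : forall X : C, fmap (idm X) = idm (fobj X);
  fmapM : forall (X Y Z : C) (g : mor Y Z) (f : mor X Y),
    fmap (g ∘ f) = fmap g ∘ fmap f }.

Arguments fmap {C D} F {X Y} f : rename.

Definition comp_functor (C D E : category) (G : functor D E) (F : functor C D) :
  functor C E.
Proof.
refine (@Functor C E (fun X => G (F X)) (fun X Y f => fmap G (fmap F f)) _ _).
- by move=> X; rewrite !fmap1.
- by move=> X Y Z g f; rewrite !fmapM.
Defined.

Record nat_trans (C D : category) (F G : functor C D) := NatTrans {
  nt :> forall X : C, mor (F X) (G X);
  ntP : forall (X Y : C) (u : mor X Y), nt Y ∘ fmap F u = fmap G u ∘ nt X }.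

Lemma nat_trans_ext (C D : category) (F G : functor C D) (a b : nat_trans F G) :
  (forall X, a X = b X) -> a = b.
Proof.
case: a b => [a aP] [b bP] /= ab.
have {}ab : a = b by apply: functional_extensionality_dep.
by case: _ / ab bP => bP; rewrite (Prop_irrelevance aP bP).
Qed.

Definition nt_id (C D : category) (F : functor C D) : nat_trans F F.
Proof.
refine (@NatTrans C D F F (fun X => idm (F X)) _).
by move=> X Y u; rewrite comp1m compm1.
Defined.

Definition nt_comp (C D : category) (F G H : functor C D)
  (b : nat_trans G H) (a : nat_trans F G) : nat_trans F H.
Proof.
refine (@NatTrans C D F H (fun X => b X ∘ a X) _).
by move=> X Y u; rewrite -compA ntP !compA ntP.
Defined.

Definition Fun (C D : category) : category.
Proof.
refine (@Category (functor C D) (@nat_trans C D) (@nt_id C D) (@nt_comp C D)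
  _ _ _).
- by move=> *; apply: nat_trans_ext => X /=; rewrite compA.
- by move=> *; apply: nat_trans_ext => X /=; rewrite comp1m.
- by move=> *; apply: nat_trans_ext => X /=; rewrite compm1.
Defined.

(* The category with objects T and Hom(x, y) := Hom_C(v x, v y); when v forgets
   a property of objects of C, this is the full subcategory of C it defines. *)
Definition full_sub (C : category) (T : Type) (v : T -> C) : category :=
  @Category T (fun x y => mor (v x) (v y)) (fun x => idm (v x))
    (fun x y z g f => g ∘ f)
    (fun x y z t h g f => compA h g f)
    (fun x y f => comp1m f) (fun x y f => compm1 f).

Definition full_incl (C : category) (T : Type) (v : T -> C) :
    functor (full_sub v) C :=
  @Functor (full_sub v) C v (fun x y f => f) (fun x => erefl)
    (fun x y z g f => erefl).

Definition poset_cat d (T : porderType d) : category.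
Proof.
refine (@Category T (fun x y => x <= y)%O (fun x => lexx x)
  (fun x y z yz xy => le_trans xy yz) _ _ _);
  by move=> *; exact: Prop_irrelevance.
Defined.

Definition is_cone (J C : category) (F : functor J C) (X : C)
    (p : forall j : J, mor X (F j)) : Prop :=
  forall (i j : J) (u : mor i j), fmap F u ∘ p i = p j.

Arguments is_cone {J C} F {X} p.

Definition is_limit (J C : category) (F : functor J C) (X : C)
    (p : forall j : J, mor X (F j)) : Prop :=
  is_cone F p /\
  forall (T : C) (q : forall j : J, mor T (F j)), is_cone F q ->
    exists! h : mor T X, forall j : J, p j ∘ h = q j.

Arguments is_limit {J C} F {X} p.

Definition is_cocone (J C : category) (F : functor J C) (X : C)
    (p : forall j : J, mor (F j) X) : Prop :=
  forall (i j : J) (u : mor i j), p j ∘ fmap F u = p i.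

Arguments is_cocone {J C} F {X} p.

Definition is_colimit (J C : category) (F : functor J C) (X : C)
    (p : forall j : J, mor (F j) X) : Prop :=
  is_cocone F p /\
  forall (T : C) (q : forall j : J, mor (F j) T), is_cocone F q ->
    exists! h : mor X T, forall j : J, h ∘ p j = q j.

Arguments is_colimit {J C} F {X} p.

(* [GRing.Zmodule] also contains a choice operator on the hom-sets; classically
   every type has one, so this is no restriction. *)
Record hom_group_cat := HomGroupCat {
  hgc_cat :> category;
  hgc_zmod : forall X Y : hgc_cat, GRing.Zmodule (mor X Y) }.

HB.instance Definition _ (A : hom_group_cat) (X Y : A) := hgc_zmod X Y.

Record additive := Additive {
  add_cat :> hom_group_cat;
  compDl : forall (X Y Z : add_cat) (g h : mor Y Z) (f : mor X Y),
    (g + h) ∘ f = g ∘ f + h ∘ f;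
  compDr : forall (X Y Z : add_cat) (g : mor Y Z) (f h : mor X Y),
    g ∘ (f + h) = g ∘ f + g ∘ h;
  add_zero : exists Z : add_cat, is_zero_obj Z;
  biprod : add_cat -> add_cat -> add_cat;
  in1 : forall X Y, mor X (biprod X Y);
  in2 : forall X Y, mor Y (biprod X Y);
  pr1 : forall X Y, mor (biprod X Y) X;
  pr2 : forall X Y, mor (biprod X Y) Y;
  pr1_in1 : forall X Y, pr1 X Y ∘ in1 X Y = idm X;
  pr2_in2 : forall X Y, pr2 X Y ∘ in2 X Y = idm Y;
  pr1_in2 : forall X Y, pr1 X Y ∘ in2 X Y = 0;
  pr2_in1 : forall X Y, pr2 X Y ∘ in1 X Y = 0;
  in_pr : forall X Y,
    in1 X Y ∘ pr1 X Y + in2 X Y ∘ pr2 X Y = idm (biprod X Y) }.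

Arguments in1 {a X Y}.
Arguments in2 {a X Y}.
Arguments pr1 {a X Y}.
Arguments pr2 {a X Y}.

Definition is_kernel (A : additive) (K X Y : A) (f : mor X Y) (k : mor K X) :
    Prop :=
  f ∘ k = 0 /\
  forall (T : A) (g : mor T X), f ∘ g = 0 -> exists! h : mor T K, k ∘ h = g.

Definition is_cokernel (A : additive) (X Y Q : A) (f : mor X Y) (c : mor Y Q) :
    Prop :=
  c ∘ f = 0 /\
  forall (T : A) (g : mor Y T), g ∘ f = 0 -> exists! h : mor Q T, h ∘ c = g.

(* Kernels and cokernels are chosen; every notion below is invariant under
   changing the choice. *)
Record preabelian := Preabelian {
  pre_add :> additive;
  ker : forall X Y : pre_add, mor X Y -> pre_add;
  kerm : forall (X Y : pre_add) (f : mor X Y), mor (ker f) X;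
  kermP : forall (X Y : pre_add) (f : mor X Y), is_kernel f (kerm f);
  coker : forall X Y : pre_add, mor X Y -> pre_add;
  cokerm : forall (X Y : pre_add) (f : mor X Y), mor Y (coker f);
  cokermP : forall (X Y : pre_add) (f : mor X Y), is_cokernel f (cokerm f) }.

Arguments ker {p X Y} f.
Arguments kerm {p X Y} f.
Arguments coker {p X Y} f.
Arguments cokerm {p X Y} f.

Record quasi_abelian := QuasiAbelian {
  qa_pre :> preabelian;
  pushout_kernel : forall (X Y Z P : qa_pre)
      (f : mor Z X) (g : mor Z Y) (p : mor X P) (q : mor Y P),
    is_pushout f g p q ->
    (exists (T : qa_pre) (t : mor X T), is_kernel t f) ->
    exists (T : qa_pre) (t : mor P T), is_kernel t q;
  pullback_cokernel : forall (X Y Z P : qa_pre)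
      (f : mor X Z) (g : mor Y Z) (p : mor P X) (q : mor P Y),
    is_pullback f g p q ->
    (exists (T : qa_pre) (t : mor T X), is_cokernel t f) ->
    exists (T : qa_pre) (t : mor T P), is_cokernel t q }.

Section Preabelian.
Variable A : preabelian.
Implicit Types X Y Z : A.

Definition coim X Y (f : mor X Y) : A := coker (kerm f).
Definition coimm X Y (f : mor X Y) : mor X (coim f) := cokerm (kerm f).
Definition im X Y (f : mor X Y) : A := ker (cokerm f).
Definition imm X Y (f : mor X Y) : mor (im f) Y := kerm (cokerm f).

(* The equation determines u, since coimm f is epi and imm f is monic. *)
Definition strict X Y (f : mor X Y) : Prop :=
  exists2 u : mor (coim f) (im f), imm f ∘ (u ∘ coimm f) = f & is_iso u.

Definition strict_monic X Y (f : mor X Y) : Prop := is_monic f /\ strict f.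

(* For subobjects s, t of X: s <= t, and the canonical morphism S -> T over X
   (unique, since t is monic) is an isomorphism. *)
Definition incl_iso X (S T : A) (s : mor S X) (t : mor T X) : Prop :=
  exists2 h : mor S T, t ∘ h = s & is_iso h.

Definition pb X Y Z (f : mor X Z) (g : mor Y Z) : A := ker (f ∘ pr1 - g ∘ pr2).
Definition pb1 X Y Z (f : mor X Z) (g : mor Y Z) : mor (pb f g) X :=
  pr1 ∘ kerm (f ∘ pr1 - g ∘ pr2).
Definition pb2 X Y Z (f : mor X Z) (g : mor Y Z) : mor (pb f g) Y :=
  pr2 ∘ kerm (f ∘ pr1 - g ∘ pr2).

(* Subobjects are represented by their morphism into the ambient object. *)

Definition capm X (S T : A) (s : mor S X) (t : mor T X) : mor (pb s t) X :=
  s ∘ pb1 s t.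

Definition copair X (S T : A) (s : mor S X) (t : mor T X) :
    mor (biprod S T) X := s ∘ pr1 + t ∘ pr2.

Definition sumo X (S T : A) (s : mor S X) (t : mor T X) : A := im (copair s t).
Definition summ X (S T : A) (s : mor S X) (t : mor T X) : mor (sumo s t) X :=
  imm (copair s t).

Definition imagem X Y (f : mor X Y) (S : A) (s : mor S X) : mor (im (f ∘ s)) Y :=
  imm (f ∘ s).

Definition preimm X Y (f : mor X Y) (T : A) (t : mor T Y) : mor (pb f t) X :=
  pb1 f t.

(* For subobjects k <= s <= t of X, with inclusions i : K -> S and j : S -> T:
   the induced morphism S/K -> T/K is an isomorphism. The morphisms i, j and v
   are determined by their equations. *)
Definition quotient_iso X (K S T : A) (k : mor K X) (s : mor S X) (t : mor T X) :
    Prop :=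
  exists (i : mor K S) (j : mor S T) (v : mor (coker i) (coker (j ∘ i))),
    [/\ s ∘ i = k, t ∘ j = s, v ∘ cokerm i = cokerm (j ∘ i) ∘ j & is_iso v].

Definition modular_law : Prop :=
  forall (X SA SB SC : A) (a : mor SA SB) (b : mor SB X) (c : mor SC X),
    strict_monic a -> strict_monic b -> strict_monic c ->
    incl_iso (summ (b ∘ a) (capm b c)) (capm b (summ (b ∘ a) c)).

Lemma comp0r X Y Z (g : mor Y Z) : g ∘ (0 : mor X Y) = 0.
Proof. by apply: (addrI (g ∘ 0)); rewrite -compDr !addr0. Qed.

Lemma comp0l X Y Z (f : mor X Y) : (0 : mor Y Z) ∘ f = 0.
Proof. by apply: (addrI (0 ∘ f)); rewrite -compDl !addr0. Qed.

Lemma compNl X Y Z (g : mor Y Z) (f : mor X Y) : (- g) ∘ f = - (g ∘ f).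
Proof. by apply: (addrI (g ∘ f)); rewrite -compDl !subrr comp0l. Qed.

Lemma pbP X Y Z (f : mor X Z) (g : mor Y Z) :
  is_pullback f g (pb1 f g) (pb2 f g).
Proof.
rewrite /pb1 /pb2; set d := f ∘ pr1 - g ∘ pr2.
have [dk univ] := kermP d; split.
  by apply/eqP; rewrite -subr_eq0 !compA -compNl -compDl; apply/eqP.
move=> T x y fxgy.
have xy1 : pr1 ∘ (in1 ∘ x + in2 ∘ y) = x :> mor T X.
  by rewrite compDr !compA pr1_in1 pr1_in2 comp1m comp0l addr0.
have xy2 : pr2 ∘ (in1 ∘ x + in2 ∘ y) = y :> mor T Y.
  by rewrite compDr !compA pr2_in1 pr2_in2 comp1m comp0l add0r.
have [|h [hE huniq]] := univ T (in1 ∘ x + in2 ∘ y).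
  by rewrite /d compDl compNl -!compA xy1 xy2 fxgy subrr.
exists h; split; first by rewrite -!compA hE.
move=> h' [h1 h2]; apply: huniq.
by rewrite -[LHS]comp1m -in_pr compDl -h1 -h2 !compA.
Qed.

End Preabelian.

Section Filtrations.
Variables (L : porderZmodType) (A : preabelian).

Definition above (l : L) : category :=
  full_sub (sval : {m : L | l < m} -> poset_cat L).

Definition above_incl (l : L) : functor (above l) (poset_cat L) := full_incl _.

(* A filtration on [vertex]; the maps [leg l] form the colimit cone. *)
Record filtration := Filtration {
  fil :> functor (poset_cat L) A;
  vertex : A;
  leg : forall l : L, mor (fil l) vertex;
  fil_exhaustive : is_colimit fil leg;
  leg_strict : forall l : L, strict_monic (leg l);
  fil_separated : exists (Z : A) (p : forall l : L, mor Z (fil l)),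
    is_limit fil p /\ is_zero_obj Z;
  fil_right_continuous : forall l : L,
    is_limit (comp_functor fil (above_incl l))
      (fun m => @fmap _ _ fil l (sval m) (ltW (svalP m))) }.

(* s is the list of breaks. The transition map from l to m is invertible exactly
   when no break lies in ]l, m], the filtration is 0 below all breaks, and it is
   the whole vertex from the last break on. The empty list is the case of the
   filtrations on zero objects. *)
Definition is_finite (W : filtration) : Prop :=
  exists s : seq L,
    [/\ sorted <%R s,
        forall l : L, all (fun b => l < b) s -> is_zero_obj (W l),
        forall (l m : L) (lm : l <= m),
          is_iso (@fmap _ _ W l m lm) <-> ~~ has (fun b => l < b <= m) s
      & forall l : L, all (fun b => b <= l) s -> is_iso (leg W l)].

(* Morphisms are all natural transformations, so recording a colimit cone in the
   objects does not change the category up to equivalence. *)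
Definition WApre : category :=
  full_sub (fun W : {W : filtration | is_finite W} =>
              fil (sval W) : Fun (poset_cat L) A).

Section Underlying.
Variables (M N : WApre) (f : mor M N).

Lemma underlying_exists :
  exists u : mor (vertex (sval M)) (vertex (sval N)),
    forall l : L, u ∘ leg (sval M) l = leg (sval N) l ∘ (f : nat_trans _ _) l.
Proof.
have [_ univ] := fil_exhaustive (sval M).
have [|u [uE _]] :=
  univ _ (fun l => leg (sval N) l ∘ (f : nat_trans _ _) l); last by exists u.
move=> i j u; rewrite -compA ntP compA.
by have [-> _] := fil_exhaustive (sval N).
Qed.

(* Unique by the universal property of the colimit cone of M. *)
Definition underlying : mor (vertex (sval M)) (vertex (sval N)) :=
  sval (cid underlying_exists).

Definition strictly_compatible : Prop :=
  forall l : L,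
    incl_iso (imagem underlying (leg (sval M) l))
             (capm (imm underlying) (leg (sval N) l)).

Definition strictly_cocompatible : Prop :=
  forall l : L,
    quotient_iso (kerm underlying)
                 (summ (leg (sval M) l) (kerm underlying))
                 (preimm underlying (leg (sval N) l)).

End Underlying.

End Filtrations.

(* [porderZmodType] does not relate the order to the addition. *)
Definition totally_ordered_group (L : porderZmodType) : Prop :=
  (forall x y : L, (x <= y) || (y <= x)) /\
  (forall x y z : L, x <= y -> x + z <= y + z).

Definition uniquely_divisible (L : zmodType) : Prop :=
  forall (n : nat) (x : L), (0 < n)%N -> exists! y : L, y *+ n = x.

(* Main.v *)
(** For an epi-monic f : M → N of 𝒜, strict compatibility of filtrations says
    that W_λ N is the closed image f(W_λ M), and strict co-compatibility that
    W_λ M is the preimage of W_λ N.  The modular law, applied in M ⊕ N to the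
    graph of f, gives f^-1(f(S)) = S and f(f^-1(T)) = T for strict S and T, so
    that both conditions agree.  Conversely, if they agree, then filtering M by
    0 ⊂ S ⊂ M and N by 0 ⊂ N shows that f(S) = N forces S = M.  If P ≤ Q
    denote the two sides of the modular law for A, B, C and X' = A + C, this
    applies to the epi-monic Q/(Q ∩ C) → X'/C and the closed image S of P,
    whence P = Q.  In WApre, a morphism is epi-monic if and only if the
    underlying one in 𝒜 is, as seen by testing on filtrations with one break. *)
Require Import Defs.
From mathcomp Require Import all_boot all_order all_algebra.
From mathcomp Require Import boolp.

Set Implicit Arguments.
Unset Strict Implicit.
Unset Printing Implicit Defensive.

Import Order.TTheory GRing.Theory Defs.

Local Open Scope ring_scope.
Local Open Scope cat_scope.

(** * The factorization preorder on morphisms into an object; on monics it is the inclusion of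
    subobjects *)

Definition factors (C : category) (S T X : C) (s : mor S X) (t : mor T X) :=
  exists h : mor S T, t ∘ h = s.

Notation "s ⊑ t" := (factors s t) (at level 70, no associativity).

Section Categories.
Variable C : category.
Implicit Types S T U X Y Z : C.

Lemma factors_refl S X (s : mor S X) : s ⊑ s.
Proof. by exists (idm S); rewrite compm1. Qed.

Lemma factors_trans S T U X (s : mor S X) (t : mor T X) (u : mor U X) :
  s ⊑ t -> t ⊑ u -> s ⊑ u.
Proof. by move=> [h <-] [k <-]; exists (k ∘ h); rewrite compA. Qed.

Lemma factors_compr S T X Y (s : mor S X) (t : mor T X) (x : mor Y S) :
  s ⊑ t -> s ∘ x ⊑ t.
Proof. by move=> [h <-]; exists (h ∘ x); rewrite compA. Qed.

Lemma factors_compl S T X Y (f : mor X Y) (s : mor S X) (t : mor T X) :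
  s ⊑ t -> f ∘ s ⊑ f ∘ t.
Proof. by move=> [h <-]; exists h; rewrite compA. Qed.

Lemma comp_factors S X Y (f : mor X Y) (x : mor S X) : f ∘ x ⊑ f.
Proof. exact: factors_compr (factors_refl f). Qed.

Lemma idm_iso X : is_iso (idm X).
Proof. by exists (idm X); rewrite compm1. Qed.

Lemma iso_comp X Y Z (g : mor Y Z) (f : mor X Y) :
  is_iso g -> is_iso f -> is_iso (g ∘ f).
Proof.
move=> [g' [g'g gg']] [f' [f'f ff']]; exists (f' ∘ g'); split.
  by rewrite compA -(compA f') g'g compm1.
by rewrite compA -(compA g) ff' compm1.
Qed.

Lemma iso_factors X Y Z (f : mor X Y) (s : mor Z Y) : is_iso f -> s ⊑ f.
Proof. by move=> [g [_ fg]]; exists (g ∘ s); rewrite compA fg comp1m. Qed.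

Lemma iso_monic X Y (f : mor X Y) : is_iso f -> is_monic f.
Proof.
by move=> [g [gf _]] Z x y E; rewrite -[x]comp1m -[y]comp1m -gf -!compA E.
Qed.

Lemma iso_epi X Y (f : mor X Y) : is_iso f -> is_epi f.
Proof.
by move=> [g [_ fg]] Z x y E; rewrite -[x]compm1 -[y]compm1 -fg !compA E.
Qed.

Lemma monic_idm_factors_iso X Y (f : mor X Y) :
  is_monic f -> idm Y ⊑ f -> is_iso f.
Proof.
move=> mf [g fg]; exists g; split=> //; apply: mf.
by rewrite compA fg comp1m compm1.
Qed.

Lemma iso_cancell X Y Z (g : mor Y Z) (f : mor X Y) :
  is_iso (g ∘ f) -> is_iso g -> is_iso f.
Proof.
move=> gfi gi; have [g' [g'g gg']] := gi.
rewrite -[f]comp1m -g'g -compA; apply: iso_comp => //.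
by exists g.
Qed.

Lemma monic_cancell X Y Z (g : mor Y Z) (f : mor X Y) :
  is_monic (g ∘ f) -> is_monic f.
Proof. by move=> gfm T x y E; apply: gfm; rewrite -!compA E. Qed.

Lemma epi_cancelr X Y Z (g : mor Y Z) (f : mor X Y) :
  is_epi (g ∘ f) -> is_epi g.
Proof. by move=> gfe T x y E; apply: gfe; rewrite !compA E. Qed.

Lemma monic_comp X Y Z (g : mor Y Z) (f : mor X Y) :
  is_monic g -> is_monic f -> is_monic (g ∘ f).
Proof. by move=> gm fm T x y; rewrite -!compA => /gm/fm. Qed.

End Categories.

(** Factorizations through monics are unique, so two opposite ones are mutually inverse. Isomorphism
    of subobjects thus becomes a pair of inclusions. *)
Lemma incl_isoP (A : preabelian) (S T X : A) (s : mor S X) (t : mor T X) :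
  is_monic s -> is_monic t -> incl_iso s t <-> (s ⊑ t /\ t ⊑ s).
Proof.
move=> sm tm; split=> [[h th [g [gh hg]]]|[[h th] [g sg]]].
  by split; [exists h | exists g; rewrite -th -compA hg compm1].
by exists h => //; exists g; split; [apply: sm | apply: tm];
  rewrite compA ?th ?sg ?compm1 ?th.
Qed.

(** * Zero objects and kernels *)

Section NormalMonics.
Variable A : preabelian.
Implicit Types S T X Y Z K Q : A.

Lemma compBl X Y Z (g h : mor Y Z) (f : mor X Y) :
  (g - h) ∘ f = g ∘ f - h ∘ f.
Proof. by apply: (addIr (h ∘ f)); rewrite -compDl !subrK. Qed.

Lemma compBr X Y Z (g : mor Y Z) (f h : mor X Y) :
  g ∘ (f - h) = g ∘ f - g ∘ h.
Proof. by apply: (addIr (g ∘ h)); rewrite -compDr !subrK. Qed.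

Lemma monicP X Y (f : mor X Y) :
  is_monic f <-> (forall Z (x : mor Z X), f ∘ x = 0 -> x = 0).
Proof.
split=> [fm Z x fx|fm Z x y E]; first by apply: fm; rewrite fx comp0r.
by apply/eqP; rewrite -subr_eq0; apply/eqP/fm; rewrite compBr E subrr.
Qed.

Lemma epiP X Y (f : mor X Y) :
  is_epi f <-> (forall Z (x : mor Y Z), x ∘ f = 0 -> x = 0).
Proof.
split=> [fm Z x fx|fm Z x y E]; first by apply: fm; rewrite fx comp0l.
by apply/eqP; rewrite -subr_eq0; apply/eqP/fm; rewrite compBl E subrr.
Qed.

Lemma zero_objP Z : is_zero_obj Z <-> idm Z = 0.
Proof.
split=> [[Z0 _]|E]; first by have [f [_ u]] := Z0 Z; apply: etrans (esym (u (idm Z) I)) (u 0 I).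
split=> X; exists 0; split=> // f _.
  by rewrite -[f]comp1m E comp0l.
by rewrite -[f]compm1 E comp0r.
Qed.

Lemma to_zero_obj X Z (f : mor X Z) : is_zero_obj Z -> f = 0.
Proof. by move=> /zero_objP E; rewrite -[f]comp1m E comp0l. Qed.

Lemma from_zero_obj X Z (f : mor Z X) : is_zero_obj Z -> f = 0.
Proof. by move=> /zero_objP E; rewrite -[f]compm1 E comp0r. Qed.

Lemma zero_obj_iso X Y (f : mor X Y) :
  is_zero_obj X -> is_zero_obj Y -> is_iso f.
Proof.
move=> X0 Y0; exists 0; rewrite comp0r comp0l.
by move/zero_objP: X0 => ->; move/zero_objP: Y0 => ->.
Qed.

Lemma monic_to_zero X Y (f : mor X Y) :
  is_monic f -> is_zero_obj Y -> is_zero_obj X.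
Proof.
by move=> fm Y0; apply/zero_objP; apply: fm; rewrite (to_zero_obj f Y0) !comp0l.
Qed.

Lemma iso_from_zero X Y (f : mor X Y) :
  is_iso f -> is_zero_obj X -> is_zero_obj Y.
Proof.
by move=> [g [_ fg]] X0; apply/zero_objP; rewrite -fg (from_zero_obj f X0) comp0l.
Qed.

Lemma factors0 S T X (t : mor T X) : (0 : mor S X) ⊑ t.
Proof. by exists 0; rewrite comp0r. Qed.

Lemma factorsB S T X (s s' : mor S X) (t : mor T X) :
  s ⊑ t -> s' ⊑ t -> s - s' ⊑ t.
Proof. by move=> [h <-] [h' <-]; exists (h - h'); rewrite compBr. Qed.

Lemma factorsD S T X (s s' : mor S X) (t : mor T X) :
  s ⊑ t -> s' ⊑ t -> s + s' ⊑ t.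
Proof. by move=> [h <-] [h' <-]; exists (h + h'); rewrite compDr. Qed.

(** Uniqueness in the universal property amounts to [k] being monic; what remains is a membership
    test for generalized elements [g]. *)
Lemma kernelP K X Y (f : mor X Y) (k : mor K X) :
  is_kernel f k <->
  is_monic k /\ forall T (g : mor T X), f ∘ g = 0 <-> g ⊑ k.
Proof.
split=> [[fk univ]|[km univ]].
  split=> [T x y E|T g].
    have [|h [_ u]] := univ T (k ∘ x); first by rewrite compA fk comp0l.
    by apply: etrans (esym (u x _)) (u y _).
  split=> [/univ[h [kh _]]|[h <-]]; first by exists h.
  by rewrite compA fk comp0l.
split=> [|T g /univ[h kh]]; first by apply/univ/factors_refl.
by exists h; split=> // h' kh'; apply: km; rewrite kh.
Qed.

Lemma cokernel_epi X Y Q (f : mor X Y) (c : mor Y Q) :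
  is_cokernel f c -> is_epi c.
Proof.
move=> [cf univ] T x y E.
have [|h [_ u]] := univ T (x ∘ c); first by rewrite -compA cf comp0r.
by apply: etrans (esym (u x _)) (u y _).
Qed.

(** Agrees with [strict_monic] by [strict_monicP], but supplies a morphism against which
    factorization can be tested. *)
Definition normal_monic K X (k : mor K X) :=
  exists (Y : A) (f : mor X Y), is_kernel f k.

Lemma normal_monic_monic K X (k : mor K X) : normal_monic k -> is_monic k.
Proof. by move=> [Y [f /kernelP[]]]. Qed.

Lemma normal_monic_iso K X (k : mor K X) : is_iso k -> normal_monic k.
Proof.
move=> ki; exists X, 0; apply/kernelP; split=> [|T g]; first exact: iso_monic.
by rewrite comp0l; split=> // _; apply: iso_factors.
Qed.

Lemma normal_monic_zero K X (k : mor K X) : is_zero_obj K -> normal_monic k.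
Proof.
move=> K0; exists X, (idm X); apply/kernelP; split=> [|T g].
  by apply/monicP => Z x _; rewrite (to_zero_obj x K0).
rewrite comp1m; split=> [->|[h <-]]; first exact: factors0.
by rewrite (to_zero_obj h K0) comp0r.
Qed.

(** [f ∘ r] is idempotent, and [f] is the kernel of the complementary idempotent. *)
Lemma split_monic_normal X Y (f : mor X Y) (r : mor Y X) :
  r ∘ f = idm X -> normal_monic f.
Proof.
move=> rf; exists Y, (idm Y - f ∘ r); apply/kernelP; split=> [Z x y E|T g].
  by rewrite -[x]comp1m -[y]comp1m -rf -!compA E.
rewrite compBl comp1m; split=> [/eqP|[h <-]].
  by rewrite subr_eq0 => /eqP ->; rewrite -compA; apply: comp_factors.
by rewrite -compA (compA r) rf comp1m subrr.
Qed.

(** If [e ∘ k] is the kernel of [f], then [k] is the kernel of [f ∘ e]. *)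
Lemma normal_monic_sub S K X (e : mor S X) (k : mor K S) :
  is_monic e -> normal_monic (e ∘ k) -> normal_monic k.
Proof.
move=> em [Y [f /kernelP[ekm ku]]]; exists Y, (f ∘ e); apply/kernelP; split.
  exact: monic_cancell ekm.
move=> T g; rewrite -compA; split=> [/ku[h E]|[h <-]].
  by exists h; apply: em; rewrite compA.
by apply/ku; rewrite compA; apply: comp_factors.
Qed.

End NormalMonics.

(** * Images, preimages, intersections and sums in terms of factorization *)

Section StrictSubobjects.
Variable A : preabelian.
Implicit Types S T X Y Z K : A.

Lemma comp_kerm X Y (f : mor X Y) : f ∘ kerm f = 0.
Proof. by have [] := kermP f. Qed.

Lemma comp_cokerm X Y (f : mor X Y) : cokerm f ∘ f = 0.
Proof. by have [] := cokermP f. Qed.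

Lemma kerm_monic X Y (f : mor X Y) : is_monic (kerm f).
Proof. by have /kernelP[] := kermP f. Qed.

Lemma kerm_factors X Y T (f : mor X Y) (g : mor T X) : f ∘ g = 0 <-> g ⊑ kerm f.
Proof. by have /kernelP[] := kermP f. Qed.

Lemma cokerm_epi X Y (f : mor X Y) : is_epi (cokerm f).
Proof. exact: cokernel_epi (cokermP f). Qed.

Lemma cokerm_desc X Y T (f : mor X Y) (g : mor Y T) :
  g ∘ f = 0 -> exists h, h ∘ cokerm f = g.
Proof. by move=> /((cokermP f).2 T)[h [hg _]]; exists h. Qed.

Lemma cokerm_iso X Y (f : mor X Y) : f = 0 -> is_iso (cokerm f).
Proof.
move=> f0; have [|g gc] := @cokerm_desc _ _ _ f (idm Y).
  by rewrite f0 comp0r.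
exists g; split=> //; apply: (cokerm_epi (f := f)).
by rewrite -compA gc compm1 comp1m.
Qed.

Lemma imm_normal X Y (f : mor X Y) : normal_monic (imm f).
Proof. by exists (coker f), (cokerm f); apply: kermP. Qed.

Lemma factors_imm X Y (f : mor X Y) : f ⊑ imm f.
Proof. exact/kerm_factors/comp_cokerm. Qed.

(** If [k] is the kernel of [c] and [c] kills [f], then [c] descends to [coker f] and so kills
    [imm f]. Thus the image is the least normal monic through which [f] factors. *)
Lemma imm_factors X Y K (f : mor X Y) (k : mor K Y) :
  normal_monic k -> imm f ⊑ k <-> f ⊑ k.
Proof.
move=> [Z [c /kernelP[km ku]]]; split; first exact/factors_trans/factors_imm.
move=> /ku/cokerm_desc[h hc]; apply/ku; rewrite -hc.
by rewrite -compA comp_kerm comp0r.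
Qed.

(** An epi has zero cokernel, so its image is the whole target. *)
Lemma factors_imm_epi X Y T (f : mor X Y) (g : mor T Y) : is_epi f -> g ⊑ imm f.
Proof.
move=> /epiP fe; apply/kerm_factors.
by rewrite (fe _ (cokerm f) (comp_cokerm f)) comp0l.
Qed.

Lemma epi_idm_factors_imm X Y (f : mor X Y) : idm Y ⊑ imm f -> is_epi f.
Proof.
move=> /kerm_factors; rewrite compm1 => c0; apply/epiP => T x xf.
by have [h <-] := cokerm_desc xf; rewrite c0 comp0r.
Qed.

(** A monic has zero kernel, so [coimm f] is invertible. Strictness then says that [f] and [imm f]
    are the same subobject, which for a kernel is the minimality of the image. *)
Lemma strict_monicP X Y (f : mor X Y) : strict_monic f <-> normal_monic f.
Proof.
split=> [[fm [u uE ui]]|fn].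
  have fi : is_iso (u ∘ coimm f).
    apply: iso_comp => //; apply: cokerm_iso; apply: fm.
    by rewrite comp_kerm comp0r.
  exists (coker f), (cokerm f); apply/kernelP; split=> // T g.
  rewrite kerm_factors; split=> [gi|gf].
    apply: (factors_trans gi); have [v [vu _]] := fi; exists v.
    by apply: (iso_epi fi); rewrite uE -compA vu compm1.
  exact: factors_trans gf (factors_imm f).
have fm := normal_monic_monic fn; split=> //.
have ci : is_iso (coimm f).
  by apply: cokerm_iso; apply: fm; rewrite comp_kerm comp0r.
have [v [vc cv]] := ci.
have [h hE hi] : incl_iso f (imm f).
  apply/incl_isoP => //; first exact: kerm_monic.
  split; first exact: factors_imm.
  by apply/imm_factors => //; apply: factors_refl.
exists (h ∘ v); first by rewrite -compA vc compm1.
by apply: iso_comp => //; exists (coimm f).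
Qed.

(** If [t] is the kernel of [c], its preimage is the kernel of [c ∘ f]. *)
Lemma preimm_normal X Y Z (f : mor X Z) (t : mor Y Z) :
  normal_monic t -> normal_monic (preimm f t).
Proof.
move=> [W [c /kernelP[tm tu]]]; exists W, (c ∘ f).
have [sq univ] := pbP f t; apply/kernelP; split=> [T x y E|T g].
  have Exy : pb2 f t ∘ x = pb2 f t ∘ y.
    apply: tm; rewrite [LHS]compA [RHS]compA -sq -[LHS]compA -[RHS]compA.
    by rewrite -/(preimm f t) E.
  have [|h [_ u]] := univ T (pb1 f t ∘ x) (pb2 f t ∘ x).
    by rewrite [LHS]compA [RHS]compA sq.
  by apply: etrans (esym (u x _)) (u y _).
rewrite -compA tu; split=> [[y ty]|[h <-]].
  by have [h [[hE _] _]] := univ T g y (esym ty); exists h.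
by rewrite compA sq -compA; apply: comp_factors.
Qed.

Lemma factors_preimm X Y T S (f : mor X Y) (t : mor T Y) (s : mor S X) :
  s ⊑ preimm f t <-> f ∘ s ⊑ t.
Proof.
have [sq univ] := pbP f t; split=> [[h <-]|[y ty]].
  by rewrite compA sq -compA; apply: comp_factors.
by have [h [[hE _] _]] := univ S s y (esym ty); exists h.
Qed.

Lemma factors_capm X S T K (s : mor S X) (t : mor T X) (k : mor K X) :
  k ⊑ capm s t <-> k ⊑ s /\ k ⊑ t.
Proof.
have [sq univ] := pbP s t; rewrite /capm; split.
  move=> [h <-]; split; first by rewrite -compA; apply: comp_factors.
  by rewrite sq -compA; apply: comp_factors.
move=> [[x <-] [y E]].
by have [h [[<- _] _]] := univ K x y (esym E); exists h; rewrite compA.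
Qed.

Lemma capm_factorsl X S T (s : mor S X) (t : mor T X) : capm s t ⊑ s.
Proof. by have [] := (factors_capm s t _).1 (factors_refl _). Qed.

Lemma capm_factorsr X S T (s : mor S X) (t : mor T X) : capm s t ⊑ t.
Proof. by have [] := (factors_capm s t _).1 (factors_refl _). Qed.

Lemma capm_monic X S T (s : mor S X) (t : mor T X) :
  is_monic s -> normal_monic t -> is_monic (capm s t).
Proof.
by move=> sm tn; apply: monic_comp => //; apply/normal_monic_monic/preimm_normal.
Qed.

Lemma factors_summl X S T (s : mor S X) (t : mor T X) : s ⊑ summ s t.
Proof.
have [x xE] := factors_imm (copair s t); exists (x ∘ in1).
rewrite compA xE compDl -!compA pr1_in1 pr2_in1.
by rewrite compm1 comp0r addr0.
Qed.

Lemma factors_summr X S T (s : mor S X) (t : mor T X) : t ⊑ summ s t.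
Proof.
have [x xE] := factors_imm (copair s t); exists (x ∘ in2).
rewrite compA xE compDl -!compA pr2_in2 pr1_in2.
by rewrite compm1 comp0r add0r.
Qed.

Lemma summ_factors X S T K (s : mor S X) (t : mor T X) (k : mor K X) :
  normal_monic k -> s ⊑ k -> t ⊑ k -> summ s t ⊑ k.
Proof.
by move=> kn sk tk; apply/(imm_factors _ kn)/factorsD; apply: factors_compr.
Qed.

Lemma summ_normal X S T (s : mor S X) (t : mor T X) : normal_monic (summ s t).
Proof. exact: imm_normal. Qed.

(** Quotients by zero are [S] and [T] themselves, so the condition says that the inclusion [j] is
    invertible. *)
Lemma quotient_isoP X K S T (k : mor K X) (s : mor S X) (t : mor T X) :
  k = 0 -> is_monic s -> is_monic t -> s ⊑ t ->
  quotient_iso k s t <-> t ⊑ s.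
Proof.
move=> k0 sm tm st; split=> [[i [j [v [si tj vE vi]]]]|ts].
  have i0 : i = 0 by apply: sm; rewrite si k0 comp0r.
  have ji : is_iso j.
    apply: (@iso_cancell _ _ _ _ (cokerm (j ∘ i))); last first.
      by apply: cokerm_iso; rewrite i0 comp0r.
    by rewrite -vE; apply: iso_comp => //; apply: cokerm_iso.
  have [g [_ jg]] := ji; exists g.
  by rewrite -tj -compA jg compm1.
have [j tj ji] := (incl_isoP sm tm).2 (conj st ts).
have [c' [c'c cc']] := @cokerm_iso K S 0 erefl.
exists 0, j, (cokerm (j ∘ 0) ∘ j ∘ c'); split=> //.
- by rewrite comp0r.
- by rewrite -compA c'c compm1.
apply: iso_comp; last by exists (cokerm 0).
by apply: iso_comp => //; apply: cokerm_iso; rewrite comp0r.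
Qed.

End StrictSubobjects.

(** * Coimages and images in a quasi-abelian category, and the modular law *)

Section QuasiAbelian.
Variable A : quasi_abelian.
Implicit Types X Y Z T : A.

(** Let [g ∘ x = 0]. The pullback of [coimm f] along [x] is a cokernel, hence epi, and over it [x]
    lifts to [X], where it lands in [ker f] and so dies in [coim f]. *)
Lemma coimm_desc_monic X Y (f : mor X Y) (g : mor (coim f) Y) :
  g ∘ coimm f = f -> is_monic g.
Proof.
move=> gE; apply/monicP => T x gx.
have [sq _] := pbP (coimm f) x.
have [|U [t tc]] := pullback_cokernel (pbP (coimm f) x).
  by exists (ker f), (kerm f); apply: cokermP.
apply: (cokernel_epi tc); rewrite comp0l -sq.
have /kerm_factors[y <-] : f ∘ pb1 (coimm f) x = 0.
  by rewrite -[X in X ∘ _]gE -compA sq compA gx comp0l.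
by rewrite compA comp_cokerm comp0l.
Qed.

Lemma pushout_exists X Y Z (f : mor Z X) (g : mor Z Y) :
  exists (P : A) (p : mor X P) (q : mor Y P), is_pushout f g p q.
Proof.
set d := in1 ∘ f - in2 ∘ g.
exists (coker d), (cokerm d ∘ in1), (cokerm d ∘ in2); split.
  apply/eqP; rewrite -subr_eq0 -!compA -compBr -/d; apply/eqP.
  exact: comp_cokerm.
move=> T x y E.
have xy1 : (x ∘ pr1 + y ∘ pr2) ∘ in1 = x.
  by rewrite compDl -!compA pr1_in1 pr2_in1 compm1 comp0r addr0.
have xy2 : (x ∘ pr1 + y ∘ pr2) ∘ in2 = y.
  by rewrite compDl -!compA pr2_in2 pr1_in2 compm1 comp0r add0r.
have [|h hE] := @cokerm_desc _ _ _ _ d (x ∘ pr1 + y ∘ pr2).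
  by rewrite compBr !compA xy1 xy2 E subrr.
exists h; split; first by rewrite !compA hE.
move=> h' [h1 h2]; apply: (cokerm_epi (f := d)); rewrite hE.
rewrite -[RHS]compm1 -[in RHS]in_pr compDr !compA.
by rewrite -(compA h') h1 -(compA h') h2.
Qed.

(** Dual to [coimm_desc_monic]: the pushout of [imm f] along [x] is a kernel, hence monic, and it
    kills [x]. *)
Lemma imm_lift_epi X Y (f : mor X Y) (g : mor X (im f)) :
  imm f ∘ g = f -> is_epi g.
Proof.
move=> gE; apply/epiP => T x xg.
have [P [p [q po]]] := pushout_exists (imm f) x; have [sq _] := po.
have [|U [t tk]] := pushout_kernel po.
  by exists (coker f), (cokerm f); apply: kermP.
have qm : is_monic q by apply: normal_monic_monic; exists U, t.
apply: qm; rewrite comp0r -sq.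
have [y <-] : exists y, y ∘ cokerm f = p.
  by apply: cokerm_desc; rewrite -[in LHS]gE compA sq -compA xg comp0r.
by rewrite -compA comp_kerm comp0r.
Qed.

Definition graph X Y (f : mor X Y) : mor X (biprod X Y) := in1 + in2 ∘ f.

Lemma pr1_graph X Y (f : mor X Y) : pr1 ∘ graph f = idm X.
Proof. by rewrite compDr compA pr1_in1 pr1_in2 comp0l addr0. Qed.

Lemma pr2_graph X Y (f : mor X Y) : pr2 ∘ graph f = f.
Proof. by rewrite compDr compA pr2_in2 pr2_in1 comp1m add0r. Qed.

Lemma graph_normal X Y (f : mor X Y) : normal_monic (graph f).
Proof. exact: split_monic_normal (pr1_graph f). Qed.

Lemma in1_normal X Y : normal_monic (@in1 A X Y).
Proof. exact: split_monic_normal (pr1_in1 X Y). Qed.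

Lemma modular_law_factors X SA SB SC
    (a : mor SA SB) (b : mor SB X) (c : mor SC X) :
  modular_law A -> normal_monic a -> normal_monic b -> normal_monic c ->
  capm b (summ (b ∘ a) c) ⊑ summ (b ∘ a) (capm b c).
Proof.
move=> mod an bn cn.
have := mod _ _ _ _ a b c; rewrite !strict_monicP => /(_ an bn cn).
move=> /incl_isoP[] //; first exact/normal_monic_monic/summ_normal.
by apply: capm_monic; [apply: normal_monic_monic | apply: summ_normal].
Qed.

(* The modular law for s ≤ X and the graph of f in X ⊕ Y. *)
Lemma modular_preimm_imagem X Y S (f : mor X Y) (s : mor S X) :
  modular_law A -> is_monic f -> normal_monic s ->
  preimm f (imagem f s) ⊑ s.
Proof.
move=> mod /monicP fm sn; set p := preimm f _.
have := modular_law_factors mod sn (in1_normal X Y) (graph_normal f).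
set u := summ _ (graph f); set v := summ _ _ => uv.
have un : normal_monic u by apply: summ_normal.
(* The first summand meets the graph in the kernel of [f], which is 0, so [v] lies over [s]. *)
have vs : v ⊑ preimm pr1 s.
  apply: summ_factors; first exact: preimm_normal.
    by apply/factors_preimm; rewrite compA pr1_in1 comp1m; apply: factors_refl.
  have [x xE] := capm_factorsl in1 (graph f).
  have [y yE] := capm_factorsr in1 (graph f).
  have y0 : y = 0.
    apply: fm; have -> : f ∘ y = pr2 ∘ (graph f ∘ y) by rewrite compA pr2_graph.
    by rewrite yE -xE compA pr2_in1 comp0l.
  by rewrite -yE y0 comp0r; apply: factors0.
(* The preimage of [u] under [in2] is normal, so it contains the image of [f ∘ s] once it contains
   [f ∘ s]. *)
have imu : in2 ∘ imagem f s ⊑ u.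
  apply/factors_preimm/imm_factors; first exact: preimm_normal.
  apply/factors_preimm.
  have -> : in2 ∘ (f ∘ s) = graph f ∘ s - in1 ∘ s :> mor _ (biprod X Y).
    by rewrite compDl addrC addKr compA.
  apply: factorsB; last exact: factors_summl.
  exact/factors_compr/factors_summr.
(* In elements, [(x, 0) = (x, f x) - (0, f x)] with [f x] in the image of [s]. *)
have pu : in1 ∘ p ⊑ u.
  have -> : in1 ∘ p = graph f ∘ p - in2 ∘ (f ∘ p) :> mor _ (biprod X Y).
    by rewrite compDl -compA addrK.
  apply: factorsB; first exact/factors_compr/factors_summr.
  apply: factors_trans imu; apply: factors_compl.
  by apply/factors_preimm/factors_refl.
have /factors_trans/(_ uv)/factors_trans/(_ vs) : in1 ∘ p ⊑ capm in1 u.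
  by apply/factors_capm; split=> //; apply: comp_factors.
by move/factors_preimm; rewrite compA pr1_in1 comp1m.
Qed.

(* The modular law for X ≤ X ⊕ T and the graph of f in X ⊕ Y. *)
Lemma modular_imagem_preimm X Y T (f : mor X Y) (t : mor T Y) :
  modular_law A -> is_epi f -> normal_monic t ->
  t ⊑ imagem f (preimm f t).
Proof.
move=> mod /epiP fe tn; set w := imagem f _.
pose b := preimm (@pr2 A X Y) t.
have bn : normal_monic b by apply: preimm_normal.
have [a ba] : in1 ⊑ b.
  by apply/factors_preimm; rewrite pr2_in1; apply: factors0.
have an : normal_monic a.
  by apply: (@split_monic_normal _ _ _ _ (pr1 ∘ b)); rewrite -compA ba pr1_in1.
have := modular_law_factors mod an bn (graph_normal f); rewrite ba.
set u := summ in1 (graph f); set v := summ _ _ => uv.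
(* The first summand and the graph together contain [in2 ∘ f], and what kills this kills [in2],
   since [f] is epi. *)
have in2u : in2 ⊑ u.
  apply/kerm_factors; set q := cokerm _; apply: fe; rewrite -compA.
  have -> : in2 ∘ f = graph f - in1 by rewrite addrC addKr.
  apply/kerm_factors; apply: factorsB; first exact: factors_summr.
  exact: factors_summl.
(* [b] meets the graph in the points [(x, f x)] with [f x] in [T], that is, with [x] in the preimage
   of [t]. *)
have vw : v ⊑ preimm pr2 w.
  apply: summ_factors; first exact/preimm_normal/imm_normal.
    by apply/factors_preimm; rewrite pr2_in1; apply: factors0.
  apply/factors_preimm.
  have xb := capm_factorsl b (graph f).
  have [y yE] := capm_factorsr b (graph f).
  rewrite -yE compA pr2_graph.
  apply: (factors_trans _ (factors_imm _)); apply: factors_compl.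
  by apply/factors_preimm; move/factors_preimm: xb; rewrite -yE compA pr2_graph.
have /factors_trans/(_ uv)/factors_trans/(_ vw) : in2 ∘ t ⊑ capm b u.
  apply/factors_capm; split; last exact: factors_compr.
  by apply/factors_preimm; rewrite compA pr2_in2 comp1m; apply: factors_refl.
by move/factors_preimm; rewrite compA pr2_in2 comp1m.
Qed.

Lemma normal_monic_cokerm X Y T (k : mor X Y) (g : mor T Y) :
  normal_monic k -> cokerm k ∘ g = 0 -> g ⊑ k.
Proof.
move=> kn /kerm_factors/factors_trans; apply.
by apply/imm_factors => //; apply: factors_refl.
Qed.

Lemma normal_monic_epi_iso X Y (k : mor X Y) :
  normal_monic k -> is_epi k -> is_iso k.
Proof.
move=> kn /epiP ke; apply: monic_idm_factors_iso; first exact: normal_monic_monic.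
by apply: normal_monic_cokerm => //; rewrite (ke _ _ (comp_cokerm k)) comp0l.
Qed.

(** The hypothesis is applied to the map [f] from [Q/(Q ∩ C)] to [(A + C)/C] and to the closed image
    [s] of [P]. It applies because [P] contains [A], whose image in the target is already dense. *)
Lemma modular_of_dense :
  (forall X Y S (f : mor X Y) (s : mor S X), is_monic f -> is_epi f ->
     normal_monic s -> is_epi (f ∘ s) -> is_epi s) ->
  modular_law A.
Proof.
move=> dense X SA SB SC a b c /strict_monicP an /strict_monicP bn /strict_monicP cn.
have bm := normal_monic_monic bn.
set P := summ (b ∘ a) (capm b c); set Q := capm b (summ (b ∘ a) c).
have Pn : normal_monic P by apply: summ_normal.
have Qm : is_monic Q by apply: capm_monic => //; apply: summ_normal.
have PQ : P ⊑ Q.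
  apply/factors_capm; split.
    apply: summ_factors => //; first exact: comp_factors.
    exact: capm_factorsl.
  apply: summ_factors; [exact: summ_normal | exact: factors_summl|].
  apply: (factors_trans _ (factors_summr _ _)).
  exact: capm_factorsr.
apply/incl_isoP => //; first exact: normal_monic_monic.
split=> //; have [p Qp] := PQ.
have pn : normal_monic p by apply: (normal_monic_sub Qm); rewrite Qp.
(* [e] includes [A + C], and [q], [a'], [c'] are [Q], [A], [C] seen inside it. *)
pose e := summ (b ∘ a) c.
have em : is_monic e by apply/normal_monic_monic/summ_normal.
have [q eq] : Q ⊑ e := capm_factorsr _ _.
have [a' ea] : b ∘ a ⊑ e := factors_summl _ _.
have [c' ec] : c ⊑ e := factors_summr _ _.
have [x Px] : b ∘ a ⊑ P := factors_summl _ _.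
have a'E : q ∘ p ∘ x = a'.
  by apply: em; rewrite [LHS]compA [e ∘ (q ∘ p)]compA eq Qp Px ea.
have c'n : normal_monic c' by apply: (normal_monic_sub em); rewrite ec.
have k_epi : is_epi (copair a' c').
  apply: (@imm_lift_epi _ _ (copair (b ∘ a) c)).
  by rewrite compDr [X in X + _]compA [X in _ + X]compA -/(summ _ _) ea ec.
pose pi := cokerm c'; pose g := pi ∘ q.
(* [A ⊕ C] is dense in [A + C], and [C] dies in the quotient by [C]. *)
have pia_epi : is_epi (pi ∘ a').
  apply/epiP => T y ya; apply: (cokerm_epi (f := c')); rewrite comp0l.
  apply: k_epi; rewrite comp0l compDr.
  rewrite [X in X + _]compA [X in _ + X]compA -[_ ∘ a']compA ya.
  by rewrite -[_ ∘ c']compA comp_cokerm comp0r !comp0l addr0.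
have [f fg] : exists f, f ∘ coimm g = g by apply: cokerm_desc; apply: comp_kerm.
pose s := imm (coimm g ∘ p); have [l sl] := factors_imm (coimm g ∘ p).
have fsl : f ∘ s ∘ (l ∘ x) = pi ∘ a'.
  rewrite -[LHS]compA [s ∘ _]compA sl -a'E.
  by rewrite -[X in f ∘ X]compA [LHS]compA fg -[LHS]compA [q ∘ (p ∘ x)]compA.
(* Both [f] and [f ∘ s] are left factors of the epi [pi ∘ a']. *)
have s_epi : is_epi s.
  apply: (dense _ _ _ f); first exact: coimm_desc_monic fg.
  - by apply: (@epi_cancelr _ _ _ _ _ (s ∘ (l ∘ x))); rewrite [f ∘ _]compA fsl.
  - exact: imm_normal.
  - by apply: (@epi_cancelr _ _ _ _ _ (l ∘ x)); rewrite fsl.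
have cp_epi : is_epi (coimm g ∘ p).
  apply: epi_idm_factors_imm; apply: iso_factors.
  by apply: normal_monic_epi_iso => //; apply: imm_normal.
(* [ker g] lies in [B ∩ C], the second summand of [P]. *)
have gp : kerm g ⊑ p.
  have [|z zE] := @normal_monic_cokerm _ _ _ c' (q ∘ kerm g) c'n.
    by rewrite [LHS]compA; apply: comp_kerm.
  have [w wE] : Q ∘ kerm g ⊑ P.
    apply: (factors_trans _ (factors_summr _ _)); apply/factors_capm; split.
      by apply: factors_compr; apply: capm_factorsl.
    by rewrite -eq -[e ∘ _ ∘ _]compA -zE [e ∘ _]compA ec; apply: comp_factors.
  by exists w; apply: Qm; rewrite [LHS]compA Qp.
suff pi1 : is_iso p.
  by rewrite -Qp -[X in X ⊑ _]compm1; apply: factors_compl; apply: iso_factors.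
(* A morphism killing [p] kills [ker g], so it descends to [coim g], where the image of [P] is
   dense. *)
apply: normal_monic_epi_iso => //; apply/epiP => T r rp.
have [r' r'E] : exists r', r' ∘ coimm g = r.
  apply: cokerm_desc; have [z <-] := gp.
  by rewrite [LHS]compA rp comp0l.
suff r'0 : r' = 0 by rewrite -r'E r'0 comp0l.
by apply: cp_epi; rewrite comp0l [LHS]compA r'E.
Qed.

End QuasiAbelian.

(** * Totally ordered groups: midpoints, and bounds of finite lists *)

Section OrderedGroups.
Variable L : porderZmodType.
Hypothesis ordL : totally_ordered_group L.
Implicit Types x y : L.

Lemma total_leVgt x y : (x <= y) || (y < x).
Proof.
by rewrite lt_neqAle; have := ordL.1 x y; case: eqVneq => [->|]; rewrite ?lexx.
Qed.

Lemma ordered_leD2r x y z : (x + z <= y + z) = (x <= y).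
Proof.
apply/idP/idP => [/(ordL.2 _ _ (- z))|/ordL.2//]; by rewrite !addrK.
Qed.

Lemma ordered_leD2l x y z : (z + x <= z + y) = (x <= y).
Proof. by rewrite ![z + _]addrC ordered_leD2r. Qed.

Lemma ordered_ltD2l x y z : (z + x < z + y) = (x < y).
Proof. by rewrite !lt_neqAle ordered_leD2l (inj_eq (addrI z)). Qed.

(** The witness is the midpoint, half of [x + y]. Density makes step filtrations right
    continuous. *)
Lemma ordered_dense x y : uniquely_divisible L -> x < y -> exists2 z, x < z & z < y.
Proof.
move=> divL xy; have [z [zE _]] := divL 2%N (x + y) isT.
have {}zE : z + z = x + y by rewrite -zE mulr2n.
exists z; apply/negPn/negP => H.
  have zx : z <= x by have := total_leVgt z x; rewrite (negbTE H) orbF.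
  suff: y <= x by move/(lt_le_trans xy); rewrite ltxx.
  rewrite -(ordered_leD2l _ _ x) -zE.
  by apply: le_trans (_ : z + x <= _); rewrite ?ordered_leD2l ?ordered_leD2r.
have yz : y <= z by have := total_leVgt y z; rewrite (negbTE H) orbF.
suff: y <= x by move/(lt_le_trans xy); rewrite ltxx.
rewrite -(ordered_leD2r _ _ y) -zE.
by apply: le_trans (_ : z + y <= _); rewrite ?ordered_leD2l ?ordered_leD2r.
Qed.

Lemma ordered_pos_exists : (exists x, x != 0) -> exists d : L, 0 < d.
Proof.
move=> [x x0]; have := ordL.1 0 x => /orP[] xE.
  by exists x; rewrite lt_neqAle eq_sym x0.
exists (- x); rewrite -(ordered_ltD2l _ _ x) subrr addr0.
by rewrite lt_neqAle x0.
Qed.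

Lemma seq_ub_exists (s : seq L) : exists l, all (fun b => b <= l) s.
Proof.
elim: s => [|b s [l ls]]; first by exists 0.
have /orP[bl|lb] := total_leVgt b l; first by exists l; rewrite /= bl.
exists b; rewrite /= lexx; apply: sub_all ls => c /le_trans; apply; exact: ltW.
Qed.

Lemma seq_lb_exists (s : seq L) : exists l, all (fun b => l <= b) s.
Proof.
elim: s => [|b s [l ls]]; first by exists 0.
have /orP[bl|lb] := total_leVgt l b; first by exists l; rewrite /= bl.
by exists b; rewrite /= lexx; apply: sub_all ls => c; apply/le_trans/ltW.
Qed.

End OrderedGroups.

(** * Legs and morphisms of filtrations; criteria for limits and colimits *)

Section Filtrations.
Variables (L : porderZmodType) (A : preabelian).
Hypothesis ordL : totally_ordered_group L.
Implicit Types V W : filtration L A.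

Lemma leg_normal W l : normal_monic (leg W l).
Proof. exact/strict_monicP/leg_strict. Qed.

Lemma leg_monic W l : is_monic (leg W l).
Proof. exact/normal_monic_monic/leg_normal. Qed.

Lemma leg_factors W (l m : L) : l <= m -> leg W l ⊑ leg W m.
Proof.
move=> lm; have [cc _] := fil_exhaustive W.
by rewrite -(cc l m lm); apply: comp_factors.
Qed.

Lemma leg_iso_le W (l m : L) : l <= m -> is_iso (leg W l) -> is_iso (leg W m).
Proof.
move=> /(leg_factors W) lm li; apply: monic_idm_factors_iso; first exact: leg_monic.
exact: factors_trans (iso_factors _ li) lm.
Qed.

Lemma leg_iso_exists W : is_finite W -> exists l, is_iso (leg W l).
Proof.
move=> [s [_ _ _ top]]; have [l sl] := seq_ub_exists ordL s.
by exists l; apply: top.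
Qed.

Lemma fil_zero_exists W : is_finite W ->
  exists l, forall m, m < l -> is_zero_obj (W m).
Proof.
move=> [s [_ bot _ _]]; have [l sl] := seq_lb_exists ordL s.
exists l => m ml; apply: bot; apply: sub_all sl => b; exact: lt_le_trans.
Qed.

(** Naturality is automatic: it can be checked after the legs of [W], which are monic. *)
Lemma fil_morphism_exists V W (g : mor (vertex V) (vertex W)) :
  (forall l, g ∘ leg V l ⊑ leg W l) ->
  exists t : nat_trans V W, forall l, leg W l ∘ t l = g ∘ leg V l.
Proof.
move=> ex; pose t l := sval (cid (ex l)).
have tE l : leg W l ∘ t l = g ∘ leg V l by rewrite /t; case: cid.
unshelve eexists (@NatTrans _ _ V W t _) => // l m lm.
apply: leg_monic; rewrite [LHS]compA tE [RHS]compA.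
have [-> _] := fil_exhaustive W; rewrite tE -[LHS]compA.
by have [-> _] := fil_exhaustive V.
Qed.

Lemma underlyingE (M N : WApre L A) (f : mor M N) (l : L) :
  underlying f ∘ leg (sval M) l = leg (sval N) l ∘ (f : nat_trans _ _) l.
Proof. by rewrite /underlying; case: cid. Qed.

(** Past the last break of [M] the leg is invertible, so a single index determines the underlying
    morphism. *)
Lemma underlying_uniq (M N : WApre L A) (f : mor M N)
    (u : mor (vertex (sval M)) (vertex (sval N))) :
  (forall l, leg (sval N) l ∘ (f : nat_trans _ _) l = u ∘ leg (sval M) l) ->
  underlying f = u.
Proof.
move=> uE; have [l li] := leg_iso_exists (svalP M).
by apply: (iso_epi li); rewrite underlyingE uE.
Qed.

Lemma underlying_leg (M N : WApre L A) (f : mor M N) (l : L) :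
  underlying f ∘ leg (sval M) l ⊑ leg (sval N) l.
Proof. by rewrite underlyingE; apply: comp_factors. Qed.

(** Past an invertible leg all transition maps are invertible, so a cocone is determined by its
    component at [l]. *)
Lemma colimit_of_iso (F : functor (poset_cat L) A) (X : A)
    (p : forall l : L, mor (F l) X) l :
  is_cocone F p -> (forall l, is_monic (p l)) -> is_iso (p l) ->
  is_colimit F p.
Proof.
move=> cc pm pi; split=> // T q qc; have [r [rp pr]] := pi.
exists (q l ∘ r); split=> [m|h hE].
  have /orP[ml|lm] := ordL.1 m l.
    by rewrite -(cc m l ml) [LHS]compA -[_ ∘ p l]compA rp compm1; apply: qc.
  have fi : is_iso (@fmap _ _ F l m lm).
    apply: (iso_cancell (g := p m)); first by rewrite cc.
    apply: monic_idm_factors_iso => //; apply: factors_trans (iso_factors _ pi) _.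
    by rewrite -(cc l m lm); apply: comp_factors.
  apply: (iso_epi fi); rewrite -[LHS]compA cc -[LHS]compA rp compm1.
  by rewrite qc.
by apply: (iso_epi pi); rewrite -[LHS]compA rp compm1 hE.
Qed.

(** A cone vanishes at [l], hence above [l] by compatibility, and below [l] because the transition
    maps into [F l] are monic. *)
Lemma limit_zero (F : functor (poset_cat L) A) l :
  (forall (i j : L) (u : i <= j), is_monic (@fmap _ _ F i j u)) ->
  is_zero_obj (F l) ->
  exists (Z : A) (p : forall l : L, mor Z (F l)), is_limit F p /\ is_zero_obj Z.
Proof.
move=> Fm F0; have [Z Z0] := add_zero A; exists Z, (fun=> 0); split=> //.
split=> [i j u|T q qc]; first by rewrite comp0r.
exists 0; split=> [m|h _]; last by rewrite (to_zero_obj h Z0).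
rewrite comp0r; have /orP[ml|lm] := ordL.1 m l.
  by apply: (Fm _ _ ml); rewrite qc comp0r (to_zero_obj (q l) F0).
by rewrite -(qc l m lm) (to_zero_obj (q l) F0) comp0r.
Qed.

Lemma poset_mor_irrelevance (l m : L) (u v : @mor (poset_cat L) l m) : u = v.
Proof. exact: (@Prop_irrelevance (l <= m) u v). Qed.

(** The component of a cone at [m], carried back to [l], gives the mediating map: monic transition
    maps settle the components below [m], compatibility those above. *)
Lemma limit_above (F : functor (poset_cat L) A) (l m : L) (lm : l < m) :
  (forall (i j : L) (u : i <= j), is_monic (@fmap _ _ F i j u)) ->
  is_iso (@fmap _ _ F l m (ltW lm)) ->
  is_limit (comp_functor F (above_incl l))
    (fun k => @fmap _ _ F l (sval k) (ltW (svalP k))).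
Proof.
move=> Fm Fi; split=> [i j u|T q qc] /=.
  by rewrite -fmapM; congr (@fmap _ _ F _ _ _); apply: poset_mor_irrelevance.
have [r [rF Fr]] := Fi; pose m' : above l := exist _ m lm.
exists (r ∘ q m'); split=> [k|h hE].
  have /orP[km|mk] := ordL.1 (sval k) m.
    apply: (Fm _ _ km); rewrite [LHS]compA -fmapM.
    have -> : @comp (poset_cat L) _ _ _ km (ltW (svalP k)) = ltW lm.
      exact: poset_mor_irrelevance.
    by rewrite [LHS]compA Fr comp1m; rewrite -(qc k m' km).
  have -> : ltW (svalP k) = @comp (poset_cat L) l m (sval k) mk (ltW lm).
    exact: poset_mor_irrelevance.
  rewrite fmapM [LHS]compA -[_ ∘ r]compA Fr compm1; exact: (qc m' k mk).
by rewrite -(hE m') /= [LHS]compA (_ : ltW (svalP m') = ltW lm) ?rF ?comp1m.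
Qed.

End Filtrations.

(** * The filtration [0 ⊂ S ⊂ M] with jumps at [b0 < b1] *)

Section StepFiltration.
Variables (L : porderZmodType) (A : preabelian).
Hypotheses (ordL : totally_ordered_group L) (divL : uniquely_divisible L).
Variables (b0 b1 : L).
Hypothesis b01 : b0 < b1.
Variables (S M : A) (i : mor S M).
Hypothesis iN : normal_monic i.

(* The filtration is built over three levels, on which the objects and maps
   compute, rather than over L, which would require transport along case
   distinctions. *)
Inductive level := Below | Middle | Top.

Definition level_of (l : L) : level :=
  if b0 <= l then if b1 <= l then Top else Middle else Below.

Definition level_le (a b : level) : bool :=
  match a, b with
  | Below, _ | Middle, Middle | Middle, Top | Top, Top => true
  | _, _ => false
  end.

Variant level_spec (l : L) : level -> Prop :=
  | LevelBelow of l < b0 & l < b1 : level_spec l Below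
  | LevelMiddle of b0 <= l & l < b1 : level_spec l Middle
  | LevelTop of b0 <= l & b1 <= l : level_spec l Top.

Lemma levelP l : level_spec l (level_of l).
Proof.
rewrite /level_of; case: ifP => [b0l|b0l].
  case: ifP => [b1l|b1l]; constructor=> //.
  by have := total_leVgt ordL b1 l; rewrite b1l.
have lb0 : l < b0 by have := total_leVgt ordL b0 l; rewrite b0l.
by constructor=> //; apply: lt_trans b01.
Qed.

Lemma level_of_le (l m : L) : l <= m -> level_le (level_of l) (level_of m).
Proof.
move=> lm; case: (levelP l) => lb0 lb1; case: (levelP m) => // mb0 mb1.
- by have := le_lt_trans (le_trans lb0 lm) mb0; rewrite ltxx.
- by have := le_lt_trans (le_trans lb0 lm) mb0; rewrite ltxx.
- by have := le_lt_trans (le_trans lb1 lm) mb1; rewrite ltxx.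
Qed.

Definition zobj : A := sval (cid (add_zero A)).

Lemma zobjP : is_zero_obj zobj.
Proof. by rewrite /zobj; case: cid. Qed.

Definition step_obj (a : level) : A :=
  match a with Below => zobj | Middle => S | Top => M end.

Definition step_map (a b : level) : mor (step_obj a) (step_obj b) :=
  match a, b with
  | Middle, Middle => idm S
  | Middle, Top => i
  | Top, Top => idm M
  | _, _ => 0
  end.

Definition step_leg (a : level) : mor (step_obj a) M :=
  match a with Below => 0 | Middle => i | Top => idm M end.

Lemma step_leg_normal a : normal_monic (step_leg a).
Proof.
case: a => /=; [exact: normal_monic_zero zobjP | exact: iN|].
exact/normal_monic_iso/idm_iso.
Qed.

Lemma step_leg_monic a : is_monic (step_leg a).
Proof. exact/normal_monic_monic/step_leg_normal. Qed.

Lemma step_leg_map a b : level_le a b -> step_leg b ∘ step_map a b = step_leg a.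
Proof. by case: a; case: b => //= _; rewrite ?comp0r ?comp1m ?compm1. Qed.

Lemma step_map_monic a b : level_le a b -> is_monic (step_map a b).
Proof.
move=> ab; apply: (@monic_cancell _ _ _ _ (step_leg b)).
by rewrite step_leg_map //; apply: step_leg_monic.
Qed.

Lemma step_map1 a : step_map a a = idm (step_obj a).
Proof. by case: a => //=; rewrite (from_zero_obj (idm zobj) zobjP). Qed.

Definition step_functor : functor (poset_cat L) A.
Proof.
refine (@Functor (poset_cat L) A (fun l => step_obj (level_of l))
  (fun l m _ => step_map (level_of l) (level_of m)) _ _).
- by move=> l; apply: step_map1.
(* Composites are compared after the monic leg into [M], which avoids splitting into triples of
   levels. *)
- move=> l m n mn lm; apply: step_leg_monic.
  rewrite [RHS]compA !step_leg_map //; apply: level_of_le => //.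
  exact: le_trans lm mn.
Defined.

Lemma step_functor_monic (l m : L) (lm : l <= m) :
  is_monic (@fmap _ _ step_functor l m lm).
Proof. exact/step_map_monic/level_of_le. Qed.

(** Feeds [limit_above] for right continuity. Below [b1] the witness lies between [l] and the next
    of [b0], [b1]; from [b1] on, any larger element does. *)
Lemma level_of_right (l : L) : exists2 m, l < m & level_of m = level_of l.
Proof.
case: (levelP l) => [lb0 lb1|lb0 lb1|lb0 lb1].
- have [m lm mb] := ordered_dense ordL divL lb0; exists m => //.
  by case: (levelP m) => // /le_lt_trans/(_ mb); rewrite ltxx.
- have [m lm mb] := ordered_dense ordL divL lb1; exists m => //.
  case: (levelP m) => // [/(le_lt_trans (le_trans lb0 (ltW lm)))|_].
    by rewrite ltxx.
  by move=> /le_lt_trans/(_ mb); rewrite ltxx.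
have lm : l < l + (b1 - b0).
  rewrite -[X in X < _]addr0 (ordered_ltD2l ordL).
  by rewrite -(ordered_ltD2l ordL _ _ b0) addr0 addrC subrK.
exists (l + (b1 - b0)) => //.
case: (levelP _) => // [/(le_lt_trans (le_trans lb0 (ltW lm)))|_ ].
  by rewrite ltxx.
by move=> /(le_lt_trans (le_trans lb1 (ltW lm))); rewrite ltxx.
Qed.

Lemma level_of_b1 : level_of b1 = Top.
Proof. by rewrite /level_of (ltW b01) lexx. Qed.

Lemma level_of_b0 : level_of b0 = Middle.
Proof. by case: (levelP b0); rewrite ?ltxx // => _ /(lt_le_trans b01); rewrite ltxx. Qed.

Definition step_filtration : filtration L A.
Proof.
refine (@Filtration L A step_functor M (fun l => step_leg (level_of l)) _ _ _ _).
- apply: (@colimit_of_iso _ _ ordL _ _ _ b1).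
  + by move=> l m lm; apply/step_leg_map/level_of_le.
  + by move=> l; apply: step_leg_monic.
  + by rewrite /= level_of_b1; apply: idm_iso.
- by move=> l; apply/strict_monicP/step_leg_normal.
(* This index lies below [b0] by the positive amount [b1 - b0], so the filtration vanishes there. *)
- apply: (@limit_zero _ _ ordL _ (b0 - (b1 - b0))).
    exact: step_functor_monic.
  rewrite /=; case: levelP => [_ _|h _|h _]; first exact: zobjP.
  + exfalso; move: h; rewrite -(ordered_leD2r ordL _ _ (b1 - b0)) subrK.
    by rewrite addrC subrK => /(lt_le_trans b01); rewrite ltxx.
  + exfalso; move: h; rewrite -(ordered_leD2r ordL _ _ (b1 - b0)) subrK.
    by rewrite addrC subrK => /(lt_le_trans b01); rewrite ltxx.
- move=> l; have [m lm ml] := level_of_right l.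
  apply: (limit_above ordL (lm := lm)); first exact: step_functor_monic.
  by rewrite /= ml step_map1; apply: idm_iso.
Defined.

(** [is_finite] wants the map across a break to be non-invertible, so degenerate jumps are dropped;
    for zero [M] no break is left. *)
Definition step_breaks : seq L :=
  (if `[< is_zero_obj S >] then [::] else [:: b0]) ++
  (if `[< is_iso i >] then [::] else [:: b1]).

Lemma step_finite : is_finite step_filtration.
Proof.
have im := normal_monic_monic iN.
have iz : is_iso i -> is_zero_obj S -> is_zero_obj M := @iso_from_zero _ _ _ i.
have zi : is_zero_obj M -> is_zero_obj S /\ is_iso i.
  move=> M0; have S0 := monic_to_zero im M0; split=> //.
  exact: zero_obj_iso.
have z0 a : is_zero_obj (step_obj a) -> is_iso (step_map Below a).
  by move=> ?; apply: zero_obj_iso => //; apply: zobjP.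
have zI a : is_iso (step_map Below a) -> is_zero_obj (step_obj a).
  by move=> h; apply: iso_from_zero h zobjP.
exists step_breaks; rewrite /step_breaks; split.
- by case: asboolP => _; case: asboolP => _ //=; rewrite b01.
- move=> l /=; case: levelP => lb0 lb1; first by move=> _; apply: zobjP.
    case: asboolP => // _ /=.
    by move=> /andP[/(le_lt_trans lb0)]; rewrite ltxx.
  case: asboolP => S0 /=.
    case: asboolP => [/iz/(_ S0) //|_] /=.
    by move=> /andP[/(le_lt_trans lb1)]; rewrite ltxx.
  by move=> /andP[/(le_lt_trans lb0)]; rewrite ltxx.
(* Six pairs of levels remain. Equal levels have no break between them, and the map from [Below] to
   [Top] is invertible exactly when both breaks are dropped. *)
- move=> l m lm /=; have := level_of_le lm.
  case: (levelP l) => lb0 lb1; case: (levelP m) => mb0 mb1 //= _.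
  + split=> [_|_]; last exact: z0 Below zobjP.
    case: asboolP => _; case: asboolP => _ //=;
      by rewrite ?(lt_geF mb0) ?(lt_geF mb1) ?andbF.
  + split=> [/(zI Middle)/= S0|].
      case: asboolP => // _; case: asboolP => _ //=;
      by rewrite ?(lt_geF mb1) ?andbF.
    case: asboolP => [S0 _|_]; first exact: z0 Middle S0.
    by rewrite /= lb0 mb0.
  + split=> [/(zI Top)/= /zi[S0 ii]|].
      by case: asboolP => //; case: asboolP.
    case: asboolP => [S0|_] /=; last by rewrite lb0 mb0.
    case: asboolP => [ii _|_] /=; last by rewrite lb1 mb1.
    exact: (z0 Top (iz ii S0)).
  + split=> [_|_]; last exact: idm_iso.
    case: asboolP => _; case: asboolP => _ //=;
      by rewrite ?(le_gtF lb0) ?(lt_geF mb1) ?andbF.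
  + split=> [ii|].
      case: asboolP => _; case: asboolP => // _ /=.
      by rewrite (le_gtF lb0).
    rewrite has_cat negb_or => /andP[_]; case: asboolP => //= _.
    by rewrite lb1 mb1.
  + split=> [_|_]; last exact: idm_iso.
    case: asboolP => _; case: asboolP => _ //=;
      by rewrite ?(le_gtF lb0) ?(le_gtF lb1).
- move=> l /=; case: levelP => lb0 lb1 /=.
  (* Below [b0], all breaks can be at most [l] only if there are none, that is, for zero [M]. *)
  + case: asboolP => [S0|_] /=; last by rewrite (lt_geF lb0).
    case: asboolP => [ii|_] /=; last by rewrite (lt_geF lb1).
    by move=> _; apply: zero_obj_iso; [exact: zobjP | apply: iz].
  + rewrite all_cat => /andP[_]; case: asboolP => //= _.
    by rewrite (lt_geF lb1).
  + by move=> _; apply: idm_iso.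
Qed.

Definition step_WApre : WApre L A := exist _ step_filtration step_finite.

End StepFiltration.

(** * Epi-monic filtered morphisms and the two strictness conditions *)

Section EpiMonics.
Variables (L : porderZmodType) (A : preabelian).
Hypotheses (ordL : totally_ordered_group L) (divL : uniquely_divisible L).
Hypothesis ntL : exists x : L, x != 0.
Variables (M N : WApre L A) (f : mor M N).

(** The test object is [Z] with its only jump at an index [b] where the filtration of [M] has
    reached its vertex, so each morphism from [Z] to the vertex lifts. *)
Lemma underlying_monic : is_monic f -> is_monic (underlying f).
Proof.
move=> fm Z g h gh; have [d d0] := ordered_pos_exists ordL ntL.
have [b bi] := leg_iso_exists ordL (svalP M).
have bd : b < b + d by rewrite -[X in X < _]addr0 (ordered_ltD2l ordL).
pose V := step_WApre ordL divL bd (normal_monic_iso (idm_iso Z)).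
have lift (k : mor Z (vertex (sval M))) :
    exists t : mor V M, forall l, leg (sval M) l ∘ (t : nat_trans _ _) l
                                  = k ∘ leg (sval V) l.
  apply: fil_morphism_exists => l /=; case: levelP => // [_ _|bl _|bl _] /=.
  - by rewrite comp0r; apply: factors0.
  - exact/iso_factors/(leg_iso_le bl).
  - exact/iso_factors/(leg_iso_le bl).
have [s sE] := lift g; have [t tE] := lift h.
have st : s = t.
  apply: fm; apply: nat_trans_ext => l; apply: leg_monic => /=.
  rewrite [LHS]compA [RHS]compA -!underlyingE -[LHS]compA -[RHS]compA sE tE.
  by rewrite [LHS]compA [RHS]compA gh.
have Vi : is_iso (leg (sval V) b) by rewrite /= level_of_b0 //; apply: idm_iso.
by apply: (iso_epi Vi); rewrite -sE -tE st.
Qed.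

(** Dually, [Z] jumps at an index below which [N] vanishes, so each morphism from the vertex of [N]
    to [Z] lifts. *)
Lemma underlying_epi : is_epi f -> is_epi (underlying f).
Proof.
move=> fe Z g h gh; have [d d0] := ordered_pos_exists ordL ntL.
have [b bz] := fil_zero_exists ordL (svalP N).
have bd : b < b + d by rewrite -[X in X < _]addr0 (ordered_ltD2l ordL).
pose V := step_WApre ordL divL bd (normal_monic_iso (idm_iso Z)).
have lift (k : mor (vertex (sval N)) Z) :
    exists t : mor N V, forall l, leg (sval V) l ∘ (t : nat_trans _ _) l
                                  = k ∘ leg (sval N) l.
  apply: (@fil_morphism_exists _ _ (sval N) (sval V)) => l /=.
  case: levelP => // [lb _|_ _|_ _] /=.
  - by rewrite (from_zero_obj (leg _ l) (bz l lb)) comp0r; apply: factors0.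
  - exact/iso_factors/idm_iso.
  - exact/iso_factors/idm_iso.
have [s sE] := lift g; have [t tE] := lift h.
have st : s = t.
  apply: fe; apply: nat_trans_ext => l; apply: (leg_monic (W := sval V)) => /=.
  rewrite [LHS]compA [RHS]compA sE tE -[LHS]compA -[RHS]compA -underlyingE.
  by rewrite [LHS]compA [RHS]compA gh.
have [l li] := leg_iso_exists ordL (svalP N).
by apply: (iso_epi li); rewrite -sE -tE st.
Qed.

Lemma monic_of_underlying : is_monic (underlying f) -> is_monic f.
Proof.
move=> um V g h gh; apply: nat_trans_ext => l; apply: leg_monic.
apply: um; rewrite [LHS]compA [RHS]compA underlyingE -[LHS]compA -[RHS]compA.
exact: (congr1 (fun t : nat_trans (sval V) (sval N) => leg _ l ∘ t l) gh).
Qed.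

(** Legs are monic, so [underlying] is faithful; an invertible leg of [M] carries the equation to
    the vertices. *)
Lemma epi_of_underlying : is_epi (underlying f) -> is_epi f.
Proof.
move=> ue V g h gh.
suff uu : underlying g = underlying h.
  apply: nat_trans_ext => l; apply: (leg_monic (W := sval V)).
  by rewrite -!underlyingE uu.
apply: ue; have [l li] := leg_iso_exists ordL (svalP M); apply: (iso_epi li).
rewrite -[LHS]compA -[RHS]compA underlyingE [LHS]compA [RHS]compA !underlyingE.
rewrite -[LHS]compA -[RHS]compA.
exact: (congr1 (fun t : nat_trans (sval M) (sval V) => leg _ l ∘ t l) gh).
Qed.

(** The image of an epi is everything, so the intersection is the filtration step of [N] itself, and
    one of the two inclusions always holds. *)
Lemma strictly_compatibleP : is_epi (underlying f) ->
  strictly_compatible f <->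
  forall l, leg (sval N) l ⊑ imagem (underlying f) (leg (sval M) l).
Proof.
move=> ue.
have E l : incl_iso (imagem (underlying f) (leg (sval M) l))
                    (capm (imm (underlying f)) (leg (sval N) l)) <->
           leg (sval N) l ⊑ imagem (underlying f) (leg (sval M) l).
  have Nn := leg_normal (sval N) l.
  have im_cap : imagem (underlying f) (leg (sval M) l)
                ⊑ capm (imm (underlying f)) (leg (sval N) l).
    apply/factors_capm; split; first exact: factors_imm_epi.
    by apply/imm_factors => //; apply: underlying_leg.
  rewrite incl_isoP; last 2 first.
  - exact: kerm_monic.
  - by apply: capm_monic => //; apply: kerm_monic.
  split=> [[_]|NI].
    apply: factors_trans; apply/factors_capm; split; last exact: factors_refl.
    exact: factors_imm_epi.
  by split=> //; apply: factors_trans NI; apply: capm_factorsr.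
by split=> H l; apply/E/H.
Qed.

(** With zero kernel, the sum and both quotients collapse, and one of the two inclusions always
    holds. *)
Lemma strictly_cocompatibleP : is_monic (underlying f) ->
  strictly_cocompatible f <->
  forall l, preimm (underlying f) (leg (sval N) l) ⊑ leg (sval M) l.
Proof.
move=> um.
have k0 : kerm (underlying f) = 0 by apply: um; rewrite comp_kerm comp0r.
have E l : quotient_iso (kerm (underlying f))
             (summ (leg (sval M) l) (kerm (underlying f)))
             (preimm (underlying f) (leg (sval N) l)) <->
           preimm (underlying f) (leg (sval N) l) ⊑ leg (sval M) l.
  have Nn := leg_normal (sval N) l; have Mn := leg_normal (sval M) l.
  have sM : summ (leg (sval M) l) (kerm (underlying f)) ⊑ leg (sval M) l.
    by apply: summ_factors => //; [apply: factors_refl | rewrite k0; apply: factors0].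
  rewrite quotient_isoP //.
  - split=> [H|H]; first exact: factors_trans H sM.
    exact: factors_trans H (factors_summl _ _).
  - exact/normal_monic_monic/summ_normal.
  - exact/normal_monic_monic/preimm_normal.
  - by apply: (factors_trans sM); apply/factors_preimm/underlying_leg.
by split=> H l; apply/E/H.
Qed.

End EpiMonics.

(** Over the zero group, separatedness makes every filtration zero, and the right-hand side would
    hold for any [A]; [ntL] excludes this. *)
Theorem propositionA1p5 (A : quasi_abelian) (L : porderZmodType)
    (ordL : totally_ordered_group L) (divL : uniquely_divisible L)
    (ntL : exists x : L, x != 0) :
  modular_law A <->
  (forall (M N : WApre L A) (f : mor M N), is_monic f -> is_epi f ->
     (strictly_compatible f <-> strictly_cocompatible f)).
Proof.
split=> [mod M N f fm fe|compat].
  have um := underlying_monic ordL divL ntL fm.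
  have ue := underlying_epi ordL divL ntL fe.
  have Mn := leg_normal (sval M); have Nn := leg_normal (sval N).
  rewrite strictly_compatibleP // strictly_cocompatibleP //.
  (* [f^-1(W_l N) ⊂ f^-1(f(W_l M)) ⊂ W_l M], and conversely [W_l N ⊂ f(f^-1(W_l N)) ⊂ f(W_l M)]. *)
  split=> H l.
    apply: factors_trans (modular_preimm_imagem mod um (Mn l)).
    apply/factors_preimm; apply: factors_trans (H l).
    by apply/factors_preimm/factors_refl.
  apply: (factors_trans (modular_imagem_preimm mod ue (Nn l))).
  apply/imm_factors; first exact: imm_normal.
  by apply: factors_trans (factors_imm _); apply: factors_compl.
apply: modular_of_dense => X Y S g s gm ge sn gse.
have [d d0] := ordered_pos_exists ordL ntL.
(* [M] carries [0 ⊂ S ⊂ X] with jumps at 0 and [d], and [N] jumps to all of [Y] at 0, so [g]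
   respects the filtrations whatever [S] is. *)
pose M := step_WApre ordL divL d0 sn.
pose N := step_WApre ordL divL d0 (normal_monic_iso (idm_iso Y)).
have [f fE] : exists f : mor M N, forall l,
    leg (sval N) l ∘ (f : nat_trans _ _) l = g ∘ leg (sval M) l.
  apply: (@fil_morphism_exists _ _ (sval M) (sval N)) => l /=.
  case: levelP => //= _ _; first by rewrite comp0r; apply: factors0.
    exact/iso_factors/idm_iso.
  exact/iso_factors/idm_iso.
have uE : underlying f = g by apply: underlying_uniq.
have fm : is_monic f by apply: monic_of_underlying; rewrite uE.
have fe : is_epi f by apply: epi_of_underlying; rewrite // uE.
have := compat M N f fm fe.
rewrite strictly_compatibleP ?strictly_cocompatibleP uE // => -[+ _].
(* Strict compatibility is the density of [g ∘ s] between 0 and [d], and that of [g] from [d] on. *)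
have NM l : leg (sval N) l ⊑ imagem g (leg (sval M) l).
  rewrite /=; case: levelP => //= _ _; first exact: factors0.
    exact: factors_imm_epi.
  by apply: factors_imm_epi; rewrite compm1.
(* At index 0, co-compatibility puts the preimage of all of [Y], which is [X], inside [S]. *)
move=> /(_ NM 0) /=; rewrite level_of_b0 //= => NM0.
apply/iso_epi/monic_idm_factors_iso; first exact: normal_monic_monic.
by apply: factors_trans NM0; apply/factors_preimm/iso_factors/idm_iso.
Qed.
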